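(* Let $D$ be an oriented Yoshikawa diagram on a compact oriented surface $F$ (possibly with boundary) or on the plane. Then the isomorphism class of $KTQ(D)$ does not change under Yoshikawa moves. As a consequence, for a given (finite) KTQ $(X,T)$, the number of KTQ-colorings of $D$ by $(X,T)$ is an invariant of Yoshikawa moves.
   Context: A ternary quasigroup is a set $X$ with $T\colon X^3\to X$ such that in the equation $T(x_1,x_2,x_3)=x_4$ any three of $x_1,\ldots,x_4$ determine the remaining one uniquely; the resulting left, middle and right divisions $\mathcal{L},\mathcal{M},\mathcal{R}\colon X^3\to X$ are given by $\mathcal{L}(x_4,x_2,x_3)=x_1$, $\mathcal{M}(x_1,x_4,x_3)=x_2$, $\mathcal{R}(x_1,x_2,x_4)=x_3$. A knot-theoretic ternary quasigroup (KTQ) is a ternary quasigroup satisfying, for all $a,b,c,d\in X$: (A1) $T(T(a,b,c),c,d)=T\big(T(a,b,T(b,c,d)),\,T(b,c,d),\,d\big)$; (A2) $T(a,b,T(b,c,d))=T\big(a,\,T(a,b,c),\,T(T(a,b,c),c,d)\big)$. KTQs $(X,T,\mathcal{L},\mathcal{M},\mathcal{R})$ form a variety of algebras, so a KTQ can be defined by a presentation (generators and relations). A Yoshikawa diagram (marked graph diagram / ch-diagram) is a diagram of a $4$-valent graph (with circle components allowed) whose double points are either classical crossings or vertices equipped with a marker; it is oriented if the edges are oriented so that around each marked vertex incoming and outgoing edges alternate. Yoshikawa moves are the standard local moves $\Gamma_1,\ldots,\Gamma_8$ (with $\Gamma_4',\Gamma_6'$) on oriented marked graph diagrams of Yoshikawa,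 $\Gamma_1$–$\Gamma_3$ being the Reidemeister moves, performed inside discs in the surface. Regions are the connected components of the complement of the underlying $4$-valent curve of the diagram. Co-orient each edge by the normal pointing to the left of its direction. At a classical crossing the source corner has all co-orientation arrows pointing out of it and the target corner has all arrows pointing into it. The ascending path is $(r_1,r_2,r_3)$ with $r_1$ the source corner, $r_2$ the corner separated from $r_1$ by an under-arc, $r_3$ the target corner; $r_4$ is the fourth corner. $KTQ(D)$ is the KTQ presented by one generator for each region, the relation $r_4=T(r_1,r_2,r_3)$ for each classical crossing, and for each marked vertex the two relations equating the generators of opposite corners. A KTQ-coloring of $D$ by $(X,T)$ is a function from regions to $X$ satisfying these relations in $(X,T)$ (equivalently a homomorphism $KTQ(D)\to(X,T)$). *)

(* Defs.v *)
From HB Require Import structures.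
From Stdlib Require Import Relation_Operators.
From mathcomp Require Import all_boot all_algebra.
From mathcomp Require Import boolp.

Set Implicit Arguments.
Unset Strict Implicit.
Unset Printing Implicit Defensive.

Definition ternary_quasigroup (X : Type) (T : X -> X -> X -> X) : Prop :=
  [/\ forall x2 x3 x4, exists! x1, T x1 x2 x3 = x4,
      forall x1 x3 x4, exists! x2, T x1 x2 x3 = x4 &
      forall x1 x2 x4, exists! x3, T x1 x2 x3 = x4].

Definition axiom_A1 (X : Type) (T : X -> X -> X -> X) : Prop :=
  forall a b c d,
    T (T a b c) c d = T (T a b (T b c d)) (T b c d) d.

Definition axiom_A2 (X : Type) (T : X -> X -> X -> X) : Prop :=
  forall a b c d,
    T a b (T b c d) = T a (T a b c) (T (T a b c) c d).

Definition is_ktq (X : Type) (T : X -> X -> X -> X) : Prop :=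
  [/\ ternary_quasigroup T, axiom_A1 T & axiom_A2 T].

Record ktq := Ktq {
  ktq_car :> Type;
  opT : ktq_car -> ktq_car -> ktq_car -> ktq_car;
  opL : ktq_car -> ktq_car -> ktq_car -> ktq_car;
  opM : ktq_car -> ktq_car -> ktq_car -> ktq_car;
  opR : ktq_car -> ktq_car -> ktq_car -> ktq_car;
  opTP : is_ktq opT;
  opLP : forall x4 x2 x3, opT (opL x4 x2 x3) x2 x3 = x4;
  opMP : forall x1 x4 x3, opT x1 (opM x1 x4 x3) x3 = x4;
  opRP : forall x1 x2 x4, opT x1 x2 (opR x1 x2 x4) = x4
}.

Definition ktq_isomorphic (X Y : ktq) : Prop :=
  exists f : X -> Y,
    [/\ bijective f,
        forall a b c, f (opT a b c) = opT (f a) (f b) (f c),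
        forall a b c, f (opL a b c) = opL (f a) (f b) (f c),
        forall a b c, f (opM a b c) = opM (f a) (f b) (f c) &
        forall a b c, f (opR a b c) = opR (f a) (f b) (f c)].

Section Presentation.

Variable G : Type.

Inductive term : Type :=
  | Gen of G
  | tT of term & term & term
  | tL of term & term & term
  | tM of term & term & term
  | tR of term & term & term.

HB.instance Definition _ := gen_eqMixin term.
HB.instance Definition _ := gen_choiceMixin term.

Variable rels : term -> term -> Prop.

(* The equational theory of KTQs (with the divisions as operations) together
   with the relations. *)
Inductive cong : term -> term -> Prop :=
  | cong_rel t u : rels t u -> cong t u
  | cong_refl t : cong t t
  | cong_sym t u : cong t u -> cong u t
  | cong_trans t u v : cong t u -> cong u v -> cong t v
  | cong_T a b c a' b' c' : cong a a' -> cong b b' -> cong c c' ->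
      cong (tT a b c) (tT a' b' c')
  | cong_L a b c a' b' c' : cong a a' -> cong b b' -> cong c c' ->
      cong (tL a b c) (tL a' b' c')
  | cong_M a b c a' b' c' : cong a a' -> cong b b' -> cong c c' ->
      cong (tM a b c) (tM a' b' c')
  | cong_R a b c a' b' c' : cong a a' -> cong b b' -> cong c c' ->
      cong (tR a b c) (tR a' b' c')
  | cong_TL x y z : cong (tT (tL x y z) y z) x
  | cong_LT x y z : cong (tL (tT x y z) y z) x
  | cong_TM x y z : cong (tT x (tM x y z) z) y
  | cong_MT x y z : cong (tM x (tT x y z) z) y
  | cong_TR x y z : cong (tT x y (tR x y z)) z
  | cong_RT x y z : cong (tR x y (tT x y z)) z
  | cong_A1 a b c d :
      cong (tT (tT a b c) c d) (tT (tT a b (tT b c d)) (tT b c d) d)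
  | cong_A2 a b c d :
      cong (tT a b (tT b c d)) (tT a (tT a b c) (tT (tT a b c) c d)).

Definition congb : rel term := fun t u => `[< cong t u >].

Lemma congb_refl : reflexive congb.
Proof. by move=> t; apply/asboolP; exact: cong_refl. Qed.

Lemma congb_sym : symmetric congb.
Proof.
by move=> t u; apply/idP/idP => /asboolP h; apply/asboolP; exact: cong_sym.
Qed.

Lemma congb_trans : transitive congb.
Proof.
by move=> u t v /asboolP h /asboolP k; apply/asboolP; exact: cong_trans h k.
Qed.

Canonical congb_equiv := EquivRel congb congb_refl congb_sym congb_trans.

Definition presented : Type := {eq_quot congb}%qT.

Definition cls (t : term) : presented := (\pi_({eq_quot congb}) t)%qT.
Definition rep (x : presented) : term := repr (x : {eq_quot congb}%qT).

Lemma clsE t u : cls t = cls u <-> cong t u.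
Proof.
by split=> [/eqquotP /asboolP | h] //; apply/eqquotP; apply/asboolP.
Qed.

Lemma repK x : cls (rep x) = x.
Proof. exact: reprK. Qed.

Lemma cong_rep t : cong (rep (cls t)) t.
Proof. by apply/clsE; rewrite repK. Qed.

Definition pT x y z := cls (tT (rep x) (rep y) (rep z)).
Definition pL x y z := cls (tL (rep x) (rep y) (rep z)).
Definition pM x y z := cls (tM (rep x) (rep y) (rep z)).
Definition pR x y z := cls (tR (rep x) (rep y) (rep z)).

Lemma pTE a b c : pT (cls a) (cls b) (cls c) = cls (tT a b c).
Proof. by apply/clsE; apply: cong_T; exact: cong_rep. Qed.
Lemma pLE a b c : pL (cls a) (cls b) (cls c) = cls (tL a b c).
Proof. by apply/clsE; apply: cong_L; exact: cong_rep. Qed.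
Lemma pME a b c : pM (cls a) (cls b) (cls c) = cls (tM a b c).
Proof. by apply/clsE; apply: cong_M; exact: cong_rep. Qed.
Lemma pRE a b c : pR (cls a) (cls b) (cls c) = cls (tR a b c).
Proof. by apply/clsE; apply: cong_R; exact: cong_rep. Qed.

Lemma pLP x y z : pT (pL x y z) y z = x.
Proof.
rewrite -(repK x) -(repK y) -(repK z) pLE pTE.
by apply/clsE; exact: cong_TL.
Qed.
Lemma pMP x y z : pT x (pM x y z) z = y.
Proof.
rewrite -(repK x) -(repK y) -(repK z) pME pTE.
by apply/clsE; exact: cong_TM.
Qed.
Lemma pRP x y z : pT x y (pR x y z) = z.
Proof.
rewrite -(repK x) -(repK y) -(repK z) pRE pTE.
by apply/clsE; exact: cong_TR.
Qed.

Lemma pT_ktq : is_ktq pT.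
Proof.
split.
- split.
  + move=> y z x; exists (pL x y z); split; first exact: pLP.
    move=> w <-; rewrite -(repK w) -(repK y) -(repK z) pTE pLE.
    by apply/clsE; exact: cong_LT.
  + move=> x z y; exists (pM x y z); split; first exact: pMP.
    move=> w <-; rewrite -(repK w) -(repK x) -(repK z) pTE pME.
    by apply/clsE; exact: cong_MT.
  + move=> x y z; exists (pR x y z); split; first exact: pRP.
    move=> w <-; rewrite -(repK w) -(repK x) -(repK y) pTE pRE.
    by apply/clsE; exact: cong_RT.
- move=> a b c d; rewrite -(repK a) -(repK b) -(repK c) -(repK d) !pTE.
  by apply/clsE; exact: cong_A1.
- move=> a b c d; rewrite -(repK a) -(repK b) -(repK c) -(repK d) !pTE.
  by apply/clsE; exact: cong_A2.
Qed.

Definition presented_ktq : ktq := Ktq pT_ktq pLP pMP pRP.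

End Presentation.

(** A diagram on an oriented surface of finite type is encoded, up to
    orientation-preserving homeomorphism, by

    - its double points, each with its four half-edges numbered
      counterclockwise by ['I_4];
    - its darts, that is, its edges with a chosen direction of travel (each edge
      or circle component gives two darts, exchanged by [rev]), the darts
      [pos d] being those that travel along the orientation of the diagram;
    - the dart [out h] that leaves a double point along the half-edge [h]; the
      darts not of this form are those of the circle components;
    - its regions, the region [lft d] lying on the left of the dart [d]; a region
      need not be a disc, and is determined up to homeomorphism by the boundary
      curves that it has along the diagram, its genus, the number of boundary
      components of the surface that it contains, and the number of points at
      infinity that it contains (the plane being a sphere punctured once).

    Tangles, which are used to define local moves, have in addition the endpoints
    [P] on a circle bounding a disc, and [out (inr p)] is the dart that leaves
    the circle at [p].  A diagram is the case where [P] is empty (and there is no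
    circle). *)

(* The half-edges of a crossing with even numbers belong to the under-arc.  The
   marker of [Marked true] lies in the corners with even numbers and that of
   [Marked false] in the corners with odd numbers, corner [i] being the one
   between the half-edges [i] and [i + 1]. *)
Inductive vkind := Crossing | Marked of bool.

Record gmap (P : finType) := Gmap {
  vertex : finType;
  kind : vertex -> vkind;
  dart : finType;
  rev : dart -> dart;
  out : vertex * 'I_4 + P -> dart;
  pos : dart -> bool;
  region : finType;
  lft : dart -> region;
  genus : region -> nat;
  bnd : region -> nat;
  ends : region -> nat
}.

Arguments kind {P} m _ : rename.
Arguments rev {P} m _ : rename.
Arguments out {P} m _ : rename.
Arguments pos {P} m _ : rename.
Arguments lft {P} m _ : rename.
Arguments genus {P} m _ : rename.
Arguments bnd {P} m _ : rename.
Arguments ends {P} m _ : rename.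

Section Gmap.

Variable P : finType.
(* [turn p] is the endpoint that follows [p] on the circle, in the direction for
   which the arc from [p] to [turn p] is on the left of the dart leaving at [p]:
   counterclockwise around the disc if the tangle is outside of it, and clockwise
   if the tangle is inside. *)
Variable turn : P -> P.
Variable m : gmap P.

Definition next_out (h : vertex m * 'I_4 + P) : vertex m * 'I_4 + P :=
  match h with
  | inl (v, i) => inl (v, ordS i)
  | inr p => inr (turn p)
  end.

Definition half (v : vertex m) (i : 'I_4) : dart m := out m (inl (v, i)).

Definition corner (v : vertex m) (i : 'I_4) : region m := lft m (half v i).

Record gmap_wf : Prop := GmapWf {
  rev_rev : forall d, rev m (rev m d) = d;
  rev_neq : forall d, rev m d <> d;
  pos_rev : forall d, pos m (rev m d) = ~~ pos m d;
  out_inj : injective (out m);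
  out_rev : forall h, exists h', out m h' = rev m (out m h);
  lft_next : forall h, lft m (rev m (out m (next_out h))) = lft m (out m h);
  crossing_pos : forall v i, kind m v = Crossing ->
    pos m (half v (ordS (ordS i))) = ~~ pos m (half v i);
  marked_pos : forall v i s, kind m v = Marked s ->
    pos m (half v (ordS i)) = ~~ pos m (half v i)
}.

(* [d] and [d'] are consecutive, in one order or the other, when one goes along
   the boundary of a region. *)
Definition consecutive (d d' : dart m) : bool :=
  [exists h, (d == rev m (out m (next_out h))) && (d' == out m h)
          || (d' == rev m (out m (next_out h))) && (d == out m h)].

Definition nboundary (r : region m) : nat :=
  n_comp consecutive [pred d | lft m d == r].

Definition chi (r : region m) : int :=
  (2%:Z - (2 * genus m r + nboundary r + bnd m r + ends m r)%N%:Z)%R.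

End Gmap.

Arguments gmap_wf {P} turn m.
Arguments chi {P} turn m r.

Record diagram := Diagram {
  diagram_gmap :> gmap void;
  diagram_wf : gmap_wf id diagram_gmap
}.

Definition on_compact_surface (D : diagram) : Prop :=
  forall r, ends D r = 0.

Definition adjacent (D : diagram) (r r' : region D) : bool :=
  [exists d, (lft D d == r) && (lft D (rev D d) == r')].

(* A diagram with [n] double points has [2 * n] edges other than its circle
   components, hence the term [- n]. *)
Definition surface_chi (D : diagram) : int :=
  (\sum_(r : region D) chi id D r - #|vertex D|%:Z)%R.

Definition on_plane (D : diagram) : Prop :=
  [/\ n_comp (@adjacent D) predT = 1,
      surface_chi D = 1%R,
      \sum_r ends D r = 1 &
      forall r, bnd D r = 0].

Section Coloring.

Variable D : diagram.

(* The co-orientation of an edge is on the left of [pos]: at the corner between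
   the half-edges [i] and [i + 1], both arrows point out of it when [i] comes in
   and [i + 1] goes out. *)
Definition source (v : vertex D) (i : 'I_4) : bool :=
  ~~ pos D (half v i) && pos D (half v (ordS i)).

Definition opposite (i : 'I_4) : 'I_4 := ordS (ordS i).

Definition across_under (i : 'I_4) : 'I_4 :=
  if odd i then ordS i else ord_pred i.
Definition across_over (i : 'I_4) : 'I_4 :=
  if odd i then ord_pred i else ordS i.

Inductive diagram_rel : term (region D) -> term (region D) -> Prop :=
  | rel_crossing v i : kind D v = Crossing -> source v i ->
      diagram_rel
        (Gen (corner v (across_over i)))
        (tT (Gen (corner v i))
            (Gen (corner v (across_under i)))
            (Gen (corner v (opposite i))))
  | rel_marked v i s : kind D v = Marked s ->
      diagram_rel (Gen (corner v i)) (Gen (corner v (opposite i))).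

Definition KTQ : ktq := presented_ktq diagram_rel.

Variables (X : Type) (T : X -> X -> X -> X).

Definition is_coloring (f : region D -> X) : Prop :=
  (forall v i, kind D v = Crossing -> source v i ->
     f (corner v (across_over i)) =
     T (f (corner v i)) (f (corner v (across_under i)))
       (f (corner v (opposite i)))) /\
  (forall v i s, kind D v = Marked s ->
     f (corner v i) = f (corner v (opposite i))).

End Coloring.

Definition ncolorings (D : diagram) (X : finType) (T : X -> X -> X -> X) : nat :=
  #|[set f : {ffun region D -> X} | `[< is_coloring T f >]]|.

Section Filling.

Variables (n : nat) (O I : gmap 'I_n).

Definition sym_of (A B : Type) (r : A -> B -> bool) (x y : A + B) : bool :=
  match x, y with
  | inl a, inr b | inr b, inl a => r a b
  | _, _ => false
  end.

Definition same_dart (d : dart O) (d' : dart I) : bool :=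
  [exists p, (d == out O (inr p)) && (d' == rev I (out I (inr p)))
          || (d == rev O (out O (inr p))) && (d' == out I (inr p))].

Definition outer_arc (p : 'I_n) : region O := lft O (out O (inr p)).
Definition inner_arc (p : 'I_n) : region I := lft I (rev I (out I (inr p))).

Definition same_region (r : region O) (r' : region I) : bool :=
  [exists p, (r == outer_arc p) && (r' == inner_arc p)].

(* [jV], [jd] and [jR] send the double points, darts and regions of the two
   tangles to those of the diagram that contain them. *)
Record is_filling (D : diagram)
    (jV : vertex O + vertex I -> vertex D)
    (jd : dart O + dart I -> dart D)
    (jR : region O + region I -> region D) : Prop := IsFilling {
  jV_bij : bijective jV;
  jd_surj : forall d, exists x, jd x = d;
  jd_ker : forall x y, (jd x == jd y) = connect (sym_of same_dart) x y;
  jR_surj : forall r, exists x, jR x = r;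
  jR_ker : forall x y, (jR x == jR y) = connect (sym_of same_region) x y;
  kind_O : forall v, kind D (jV (inl v)) = kind O v;
  kind_I : forall v, kind D (jV (inr v)) = kind I v;
  half_O : forall v i, half (jV (inl v)) i = jd (inl (half v i));
  half_I : forall v i, half (jV (inr v)) i = jd (inr (half v i));
  rev_O : forall d, rev D (jd (inl d)) = jd (inl (rev O d));
  rev_I : forall d, rev D (jd (inr d)) = jd (inr (rev I d));
  pos_O : forall d, pos D (jd (inl d)) = pos O d;
  pos_I : forall d, pos D (jd (inr d)) = pos I d;
  lft_O : forall d, lft D (jd (inl d)) = jR (inl (lft O d));
  lft_I : forall d, lft D (jd (inr d)) = jR (inr (lft I d));
  bnd_D : forall r, bnd D r =
    \sum_(a | jR (inl a) == r) bnd O a + \sum_(a | jR (inr a) == r) bnd I a;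
  ends_D : forall r, ends D r =
    \sum_(a | jR (inl a) == r) ends O a + \sum_(a | jR (inr a) == r) ends I a;
  (* additivity of the Euler characteristic, which determines the genus *)
  chi_D : forall r, chi id D r =
    (\sum_(a | jR (inl a) == r) chi (@ordS n) O a
     + \sum_(a | jR (inr a) == r) chi (@ord_pred n) I a
     - #|[pred p | jR (inl (outer_arc p)) == r]|%:Z)%R
}.

(* [D] is obtained from the tangle [O] outside of a disc and the tangle [I] inside
   of it, with the same endpoints, by gluing along the circle. *)
Definition filling (D : diagram) : Prop :=
  exists jV jd jR, @is_filling D jV jd jR.

End Filling.

(* An unoriented tangle in a disc.  Its edges are numbered and given a reference
   direction; [(e, true)] is the dart along it and [(e, false)] the reverse one.
   [code_verts] lists the darts leaving each double point, counterclockwise;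
   [code_ends] the darts leaving the boundary circle, counterclockwise;
   [code_sides] the regions on the left and on the right of each edge.  The
   numbers of edges and of regions are [code_edges.+1] and [code_regions.+1].
   All regions are discs. *)
Record code := Code {
  code_edges : nat;
  code_regions : nat;
  code_verts : seq (vkind * seq (nat * bool));
  code_ends : seq (nat * bool);
  code_sides : seq (nat * nat)
}.

Definition fw (e : nat) : nat * bool := (e, true).
Definition bw (e : nat) : nat * bool := (e, false).

Section Tangle.

Variables (n : nat) (c : code) (o : 'I_(code_edges c).+1 -> bool).

Definition code_dart (d : nat * bool) : 'I_(code_edges c).+1 * bool :=
  (inZp d.1, d.2).

(* [o e] tells whether [e] is oriented along its reference direction. *)
Definition tangle : gmap 'I_n := {|
  vertex := 'I_(size (code_verts c));
  kind := fun v : 'I_(size (code_verts c)) => (nth (Crossing, [::]) (code_verts c) v).1;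
  dart := ('I_(code_edges c).+1 * bool)%type;
  rev := fun d : 'I_(code_edges c).+1 * bool => (d.1, ~~ d.2);
  out := fun h : 'I_(size (code_verts c)) * 'I_4 + 'I_n => code_dart
    match h with
    | inl (v, i) => nth (fw 0) (nth (Crossing, [::]) (code_verts c) v).2 i
    | inr p => nth (fw 0) (code_ends c) p
    end;
  pos := fun d : 'I_(code_edges c).+1 * bool => o d.1 == d.2;
  region := 'I_(code_regions c).+1;
  lft := fun d : 'I_(code_edges c).+1 * bool => let s := nth (0, 0) (code_sides c) d.1 in
                  inZp (if d.2 then s.1 else s.2);
  genus := fun=> 0;
  bnd := fun=> 0;
  ends := fun=> 0
|}.

End Tangle.

Definition dbl (k : vkind) (h : seq (nat * bool)) : vkind * seq (nat * bool) :=
  (k, h).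

(* The first listed half-edge is on the under-arc if and only if [~~ b]. *)
Definition crs (b : bool) (h : seq (nat * bool)) : vkind * seq (nat * bool) :=
  (Crossing, rot b h).

Definition one_strand : code :=
  Code 0 1 [::] [:: fw 0; bw 0] [:: (0, 1)].

(* A strand with a loop at a double point [x], whose half-edges are listed with
   those of the loop at the end. *)
Definition kink
    (x : seq (nat * bool) -> vkind * seq (nat * bool)) : code :=
  Code 2 2 [:: x [:: bw 0; fw 2; fw 1; bw 1]] [:: fw 0; bw 2]
    [:: (0, 1); (2, 0); (0, 1)].

Definition two_strands : code :=
  Code 1 2 [::] [:: fw 0; fw 1; bw 1; bw 0] [:: (0, 1); (1, 2)].

Definition bigon : code :=
  Code 5 4
    [:: crs false [:: bw 0; bw 3; fw 1; fw 4];
        crs false [:: bw 1; fw 5; fw 2; bw 4]]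
    [:: fw 0; fw 3; bw 5; bw 2]
    [:: (0, 1); (2, 3); (0, 4); (1, 3); (0, 2); (4, 3)].

(* Strands 0-1-2, 3-4-5 and 6-7-8: in this order of height from the bottom if
   [~~ b], from the top if [b]. *)
Definition triangle_L (b : bool) : code :=
  Code 8 6
    [:: crs b [:: bw 0; bw 3; fw 1; fw 4];
        crs b [:: bw 1; bw 6; fw 2; fw 7];
        crs b [:: bw 4; bw 7; fw 5; fw 8]]
    [:: fw 0; fw 3; fw 6; bw 2; bw 5; bw 8]
    [:: (0, 1); (2, 3); (4, 5); (1, 3); (0, 2); (6, 4); (3, 5); (2, 4); (0, 6)].
Definition triangle_R (b : bool) : code :=
  Code 8 6
    [:: crs b [:: bw 0; bw 7; fw 1; fw 8];
        crs b [:: bw 1; bw 4; fw 2; fw 5];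
        crs b [:: bw 3; bw 6; fw 4; fw 7]]
    [:: fw 0; fw 3; fw 6; bw 2; bw 5; bw 8]
    [:: (0, 1); (2, 3); (4, 5); (1, 6); (3, 5); (2, 4); (6, 5); (1, 3); (0, 2)].

(* A marked vertex with the strand 0-1-2 to its right, resp. to its left,
   crossing over its edges if [~~ b] and under them if [b]. *)
Definition strand_right (s b : bool) : code :=
  Code 8 6
    [:: dbl (Marked s) [:: fw 7; fw 3; fw 4; fw 5];
        crs b [:: fw 8; bw 0; bw 7; fw 1];
        crs b [:: fw 6; bw 1; bw 5; fw 2]]
    [:: bw 8; fw 0; bw 3; bw 4; bw 2; bw 6]
    [:: (0, 1); (2, 3); (4, 5); (6, 1); (5, 6); (3, 5); (2, 4); (1, 3); (0, 2)].
Definition strand_left (s b : bool) : code :=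
  Code 8 6
    [:: dbl (Marked s) [:: fw 7; fw 3; fw 4; fw 5];
        crs b [:: bw 3; bw 0; fw 8; fw 1];
        crs b [:: bw 4; bw 1; fw 6; fw 2]]
    [:: bw 7; fw 0; bw 8; bw 6; bw 2; bw 5]
    [:: (0, 1); (2, 3); (4, 5); (2, 0); (4, 2); (6, 4); (5, 3); (0, 6); (3, 1)].

(* A marked vertex with a half-twist of its two edges on the right, resp. on the
   left. *)
Definition twist_right (s b : bool) : code :=
  Code 5 4
    [:: dbl (Marked s) [:: fw 3; fw 0; fw 1; fw 2];
        crs b [:: fw 5; bw 3; bw 2; fw 4]]
    [:: bw 5; bw 0; bw 1; bw 4]
    [:: (0, 1); (2, 0); (3, 2); (1, 3); (4, 2); (1, 4)].
Definition twist_left (s b : bool) : code :=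
  Code 5 4
    [:: dbl (Marked s) [:: fw 5; fw 3; fw 2; fw 4];
        crs b [:: bw 3; fw 0; fw 1; bw 2]]
    [:: bw 5; bw 0; bw 1; bw 4]
    [:: (0, 1); (2, 0); (2, 3); (3, 1); (4, 2); (1, 4)].

(* Band slide.  The edge [i < 6] goes to the endpoint [i], and 6 joins the two
   vertices.  If one cuts off, at each vertex, the two corners that contain the
   marker (if [s]; the two other corners if [~~ s]), one gets the arcs 0-1, 2-3
   and 4-5, and the vertices stand for two bands: from 0-1 to 2-3 and to 4-5 in
   [slide_L], from 4-5 to 2-3 and to 0-1 in [slide_R]. *)
Definition slide_L (s : bool) : code :=
  Code 6 5
    [:: dbl (Marked (~~ s)) [:: fw 1; fw 2; fw 3; fw 6];
        dbl (Marked s) [:: fw 4; fw 5; fw 0; bw 6]]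
    [:: bw 0; bw 1; bw 2; bw 3; bw 4; bw 5]
    [:: (0, 1); (2, 0); (3, 2); (4, 3); (5, 4); (1, 5); (0, 4)].
Definition slide_R (s : bool) : code :=
  Code 6 5
    [:: dbl (Marked s) [:: fw 2; fw 3; fw 4; fw 6];
        dbl (Marked (~~ s)) [:: fw 5; fw 0; fw 1; bw 6]]
    [:: bw 0; bw 1; bw 2; bw 3; bw 4; bw 5]
    [:: (0, 1); (2, 0); (3, 2); (4, 3); (5, 4); (1, 5); (2, 5)].

(* Band pass.  A horizontal band, with upper edge 0-1-2 and lower edge 3-4-5 (from
   west to east), and a vertical band, with edges 6-7-8 and 9-10-11 (from south to
   north), which crosses over the upper edge and under the lower edge of the
   former if [~~ b], and conversely if [b].  The vertex of the horizontal band is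
   at its west end if [w] and at its east end otherwise, with two more edges 12
   and 13; that of the vertical band is at its north end if [u] and at its south
   end otherwise, with two more edges 14 and 15. *)
Definition bands (s b w u : bool) : code :=
  Code 15 10
    [:: crs b [:: fw 1; fw 8; bw 0; bw 7];
        crs b [:: fw 2; fw 11; bw 1; bw 10];
        crs b [:: fw 7; bw 3; bw 6; fw 4];
        crs b [:: fw 10; bw 4; bw 9; fw 5];
        dbl (Marked s) (if w then [:: fw 0; bw 12; bw 13; fw 3]
                        else [:: fw 12; bw 2; bw 5; fw 13]);
        dbl (Marked (~~ s)) (if u then [:: fw 15; fw 14; bw 8; bw 11]
                             else [:: fw 9; fw 6; bw 14; bw 15])]
    [:: bw (if w then 5 else 13); bw (if w then 2 else 12);
        bw (if u then 15 else 11); bw (if u then 14 else 8);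
        fw (if w then 12 else 0); fw (if w then 13 else 3);
        fw (if u then 6 else 14); fw (if u then 9 else 15)]
    [:: (0, 1); (2, 3); (4, 5); (1, 6); (3, 7); (5, 8);
        (6, 7); (1, 3); (0, 2); (7, 8); (3, 5); (2, 4);
        (if w then 0 else 4, 9); (9, if w then 6 else 8);
        (if u then 0 else 6, 10); (10, if u then 4 else 8)].

Inductive yoshikawa : nat -> code -> code -> Prop :=
  | Gamma1 b : yoshikawa 2 (kink (crs b)) one_strand
  | Gamma2 : yoshikawa 4 bigon two_strands
  | Gamma3 b : yoshikawa 6 (triangle_L b) (triangle_R b)
  | Gamma4 s : yoshikawa 6 (strand_right s false) (strand_left s false)
  | Gamma4' s : yoshikawa 6 (strand_right s true) (strand_left s true)
  | Gamma5 s b : yoshikawa 4 (twist_right s b) (twist_left s b)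
  | Gamma6 : yoshikawa 2 (kink (dbl (Marked true))) one_strand
  | Gamma6' : yoshikawa 2 (kink (dbl (Marked false))) one_strand
  | Gamma7 s : yoshikawa 6 (slide_L s) (slide_R s)
  | Gamma8 s b u u' : yoshikawa 8 (bands s b false u) (bands s b true u').

(* The orientations [oL] and [oR] agree at the endpoints, being both those of the
   darts of [O]; they are compatible with the double points since [D] and [D'] are
   well formed. *)
Inductive yoshikawa_step (D D' : diagram) : Prop :=
  | YoshikawaStep n cL cR (O : gmap 'I_n) oL oR of
      yoshikawa n cL cR & gmap_wf (@ordS n) O &
      filling O (@tangle n cL oL) D & filling O (@tangle n cR oR) D'.

Definition yoshikawa_equiv : diagram -> diagram -> Prop :=
  clos_refl_sym_trans diagram yoshikawa_step.

(* Main.v *)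
From mathcomp Require Import all_boot zmodp boolp.
Require Import Defs.

Set Implicit Arguments.
Unset Strict Implicit.
Unset Printing Implicit Defensive.

(** A coloring of a diagram obtained by gluing two tangles is a pair of colorings
    of the tangles that agree along the circle.  So a local move preserves
    colorings as soon as, for every KTQ, each coloring of one side of the move
    extends from its values on the circle to the other side, and the values on the
    circle determine the colors inside.  Both are finite checks on the tables of
    regions and crossings that encode the moves ([yoshikawa_equivalent]).

    At a crossing, the relation [r4 = T(r1, r2, r3)] depends only on heights and on
    the side of each strand on which a corner lies: reversing a strand just
    exchanges its two sides.  It determines each of its four corners from the three
    others.  This cancellation property settles all moves except the third
    Reidemeister move.  For instance the two values around a marked vertex
    alternate, so a strand passing near it crosses its edges with the same relation
    each time.

    In the third Reidemeister move, three strands give eight combinations of sides,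
    hence eight possible regions: the vertices of a cube, whose six faces carry
    crossing relations.  The regions of one side of the move are all vertices but
    one, with the three faces that avoid it; those of the other side are all
    vertices but the antipodal one.  The axioms (A1) and (A2) give the move, in one
    direction and for one choice of orientations, which singles out one vertex of
    the cube.  Cancellation carries it from a vertex to its neighbors, hence to all
    orientations and to both directions ([consistency]).

    The correspondence between the colorings of two diagrams thus obtained, which
    is that of having the same values outside of the disc, is defined for all KTQs
    at once and preserved by homomorphisms.  Since colorings of [D] by [K] are
    homomorphisms from [KTQ D] to [K], Yoneda's argument turns it into an
    isomorphism ([transfer_isomorphic]). *)

(** * The crossing relation and the cube *)

Section Crossing.

Variables (X : Type) (T : X -> X -> X -> X).
Hypothesis ktqT : is_ktq T.

Lemma ktq_inj1 x x' y z w : T x y z = w -> T x' y z = w -> x = x'.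
Proof.
case: ktqT => [[h _ _] _ _] e e'; have [v [_ u]] := h y z w.
by rewrite -(u x e) (u x' e').
Qed.

Lemma ktq_inj2 x y y' z w : T x y z = w -> T x y' z = w -> y = y'.
Proof.
case: ktqT => [[_ h _] _ _] e e'; have [v [_ u]] := h x z w.
by rewrite -(u y e) (u y' e').
Qed.

Lemma ktq_inj3 x y z z' w : T x y z = w -> T x y z' = w -> z = z'.
Proof.
case: ktqT => [[_ _ h] _ _] e e'; have [v [_ u]] := h x y w.
by rewrite -(u z e) (u z' e').
Qed.

(** The relation at a crossing whose corners have the values [x0], [x1], [x2], [x3]:
    [p] and [q] tell whether the half-edges 0 (on the under-arc) and 1 (on the
    over-arc) are outgoing.  Equivalently, if [y i j] is the value of the corner on
    the left of the under-arc iff [i] and on the left of the over-arc iff [j], it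
    says that [T (y false false) (y true false) (y true true) = y false true]. *)
Definition cross (p q : bool) (x0 x1 x2 x3 : X) : Prop :=
  match p, q with
  | false, true => T x0 x3 x2 = x1
  | false, false => T x1 x2 x3 = x0
  | true, false => T x2 x1 x0 = x3
  | true, true => T x3 x0 x1 = x2
  end.

(** Reversing the under-arc exchanges its sides, that is, the corners 0 and 3 and
    the corners 1 and 2. *)
Lemma cross_flip_under p q x0 x1 x2 x3 :
  cross (~~ p) q x3 x2 x1 x0 <-> cross p q x0 x1 x2 x3.
Proof. by case: p; case: q. Qed.

Lemma cross_flip_over p q x0 x1 x2 x3 :
  cross p (~~ q) x1 x0 x3 x2 <-> cross p q x0 x1 x2 x3.
Proof. by case: p; case: q. Qed.

Lemma cross_inj2 p q x0 x1 x2 x2' x3 :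
  cross p q x0 x1 x2 x3 -> cross p q x0 x1 x2' x3 -> x2 = x2'.
Proof.
case: p; case: q => /= e e'; first by rewrite -e -e'.
- exact: ktq_inj1 e e'.
- exact: ktq_inj3 e e'.
- exact: ktq_inj2 e e'.
Qed.

Lemma cross_solve2 p q x0 x1 x3 : exists x2, cross p q x0 x1 x2 x3.
Proof.
case: ktqT => [[h1 h2 h3] _ _]; case: p; case: q => /=.
- by eexists.
- by have [x2 [e _]] := h1 x1 x0 x3; exists x2.
- by have [x2 [e _]] := h3 x0 x3 x1; exists x2.
- by have [x2 [e _]] := h2 x1 x3 x0; exists x2.
Qed.

(** The cube whose vertices are labelled by the sets of strands that separate them
    from [x0], for strands [a], [b], [c] from the bottom to the top.  The booleans
    encode the orientations of the strands; the one of [b] is negated on the faces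
    where [b] is the upper strand, as [cross] reads the directions of an over-arc
    and of an under-arc oppositely with respect to the corner 0. *)
Definition consistent (p q r : bool) : Prop :=
  forall x0 xa xb xc xab xac xbc,
    cross p q x0 xb xab xa -> cross p r x0 xc xac xa ->
    cross (~~ q) r x0 xc xbc xb ->
  exists xabc,
    [/\ cross p q xc xbc xabc xac, cross p r xb xbc xabc xab &
        cross (~~ q) r xa xac xabc xab].

(** Here [x0] is the vertex [T(a, b, c)] of the cube built from [a], [b], [c], [d]
    and the opposite vertex is [T(b, c, d)]; the two ways of computing the last two
    vertices are the two sides of (A1) and of (A2). *)
Lemma consistent_base : consistent false false true.
Proof.
case: ktqT => _ A1 A2 e c a g b d h /= eE gE hE; exists (T b c d); split=> //.
- by rewrite -hE -gE -eE -A2 -A1.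
- by rewrite A2 eE gE hE.
Qed.

(** Consistency at a vertex gives consistency at its neighbors.  Around the
    neighbor, the unknown vertex lies on one of the faces at the old vertex, which
    defines it.  Consistency then makes the three far faces hold with some value of
    the last vertex, which is the given one by cancellation on the face where both
    appear. *)
Lemma consistent_flip1 p q r : consistent p q r -> consistent (~~ p) q r.
Proof.
move=> cons xa x0 xab xac xb xc xabc.
move=> /cross_flip_under => H1.
move=> /cross_flip_under => H2 H3.
have [xbc H4] := cross_solve2 (~~ q) r x0 xc xb.
have [y [G1 G2 G3]] := cons _ _ _ _ _ _ _ H1 H2 H4.
rewrite (cross_inj2 G3 H3) in G1 G2.
by exists xbc; split=> //; apply/cross_flip_under.
Qed.

Lemma consistent_flip2 p q r : consistent p q r -> consistent p (~~ q) r.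
Proof.
move=> cons xb xab x0 xbc xa xabc xc.
move=> /cross_flip_over => H1 H2.
move=> /cross_flip_under H3.
have [xac H4] := cross_solve2 p r x0 xc xa.
have [y [G1 G2 G3]] := cons _ _ _ _ _ _ _ H1 H4 H3.
rewrite (cross_inj2 G2 H2) in G1 G3.
by exists xac; split=> //; [apply/cross_flip_over | apply/cross_flip_under].
Qed.

Lemma consistent_flip3 p q r : consistent p q r -> consistent p q (~~ r).
Proof.
move=> cons xc xac xbc x0 xabc xa xb H1.
move=> /cross_flip_over => H2.
move=> /cross_flip_over => H3.
have [xab H4] := cross_solve2 p q x0 xb xa.
have [y [G1 G2 G3]] := cons _ _ _ _ _ _ _ H4 H2 H3.
rewrite (cross_inj2 G1 H1) in G2 G3.
by exists xab; split=> //; apply/cross_flip_over.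
Qed.

(** Reversing strands one at a time reaches all vertices of the cube. *)
Lemma consistency p q r : consistent p q r.
Proof.
have h := consistent_base.
have {h} h : consistent p false true.
  by case: p => //; apply: (@consistent_flip1 false).
have {h} h : consistent p q true.
  by case: q => //; apply: (@consistent_flip2 _ false).
by case: r => //; apply: (@consistent_flip3 _ _ true).
Qed.

End Crossing.

(** * Colorings as homomorphisms *)

Section Homomorphisms.

Definition ktq_hom (X Y : ktq) (f : X -> Y) : Prop :=
  forall a b c, f (opT a b c) = opT (f a) (f b) (f c).

Lemma ktq_hom_comp (X Y Z : ktq) (f : X -> Y) (g : Y -> Z) :
  ktq_hom f -> ktq_hom g -> ktq_hom (g \o f).
Proof. by move=> hf hg a b c; rewrite /= hf hg. Qed.

Variables (X Y : ktq) (f : X -> Y).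
Hypothesis hf : ktq_hom f.

(** A map that preserves [T] preserves the divisions, by uniqueness of the
    solutions of the equations that define them. *)
Lemma ktq_hom_opL a b c : f (opL a b c) = opL (f a) (f b) (f c).
Proof. by apply: (ktq_inj1 (opTP Y) _ (opLP _ _ _)); rewrite -hf opLP. Qed.

Lemma ktq_hom_opM a b c : f (opM a b c) = opM (f a) (f b) (f c).
Proof. by apply: (ktq_inj2 (opTP Y) _ (opMP _ _ _)); rewrite -hf opMP. Qed.

Lemma ktq_hom_opR a b c : f (opR a b c) = opR (f a) (f b) (f c).
Proof. by apply: (ktq_inj3 (opTP Y) _ (opRP _ _ _)); rewrite -hf opRP. Qed.

Lemma bijective_hom_isomorphic : bijective f -> ktq_isomorphic X Y.
Proof.
by exists f; split=> //; [apply: ktq_hom_opL|apply: ktq_hom_opM|apply: ktq_hom_opR].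
Qed.

End Homomorphisms.

Lemma ktq_isomorphic_refl X : ktq_isomorphic X X.
Proof. by exists id; split=> //; exists id. Qed.

Lemma ktq_isomorphic_sym X Y : ktq_isomorphic X Y -> ktq_isomorphic Y X.
Proof.
case=> f [[g gK fK] hf _ _ _]; apply: (@bijective_hom_isomorphic _ _ g).
  by move=> a b c; apply: (can_inj gK); rewrite hf !fK.
by exists f.
Qed.

Lemma ktq_isomorphic_trans X Y Z :
  ktq_isomorphic X Y -> ktq_isomorphic Y Z -> ktq_isomorphic X Z.
Proof.
case=> f [bf hf _ _ _] [g [bg hg _ _ _]].
by apply: (@bijective_hom_isomorphic _ _ (g \o f)); [apply: ktq_hom_comp|apply: bij_comp].
Qed.

Section UniversalProperty.

Variables (G : Type) (rels : term G -> term G -> Prop) (K : ktq).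
Let P := presented_ktq rels.

Fixpoint eval (f : G -> K) (t : term G) : K :=
  match t with
  | Gen g => f g
  | tT a b c => opT (eval f a) (eval f b) (eval f c)
  | tL a b c => opL (eval f a) (eval f b) (eval f c)
  | tM a b c => opM (eval f a) (eval f b) (eval f c)
  | tR a b c => opR (eval f a) (eval f b) (eval f c)
  end.

Lemma eval_cong (f : G -> K) :
  (forall t u, rels t u -> eval f t = eval f u) ->
  forall t u, cong rels t u -> eval f t = eval f u.
Proof.
move=> hr t u; case: (opTP K) => _ A1 A2.
elim=> {t u} /=; do ?by [congruence | move=> * /=; rewrite ?opLP ?opMP ?opRP].
- exact: hr.
- by move=> x y z; apply: (ktq_inj1 (opTP K) (opLP _ _ _)).
- by move=> x y z; apply: (ktq_inj2 (opTP K) (opMP _ _ _)).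
- by move=> x y z; apply: (ktq_inj3 (opTP K) (opRP _ _ _)).
Qed.

Lemma presented_hom (f : G -> K) :
  (forall t u, rels t u -> eval f t = eval f u) ->
  exists2 h : P -> K, ktq_hom h & forall g, h (cls rels (Gen g)) = f g.
Proof.
move=> hr; have hcls t : eval f (rep (cls rels t)) = eval f t.
  by apply: eval_cong => //; exact: cong_rep.
by exists (fun x => eval f (rep x)) => [a b c | g]; rewrite hcls.
Qed.

Lemma presented_hom_ext (h h' : P -> K) : ktq_hom h -> ktq_hom h' ->
  (forall g, h (cls rels (Gen g)) = h' (cls rels (Gen g))) -> h =1 h'.
Proof.
move=> hh hh' e x; rewrite -(repK x); elim: (rep x) => //= a ea b eb c ec.
- by rewrite -pTE hh hh' ea eb ec.
- by rewrite -pLE (ktq_hom_opL hh) (ktq_hom_opL hh') ea eb ec.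
- by rewrite -pME (ktq_hom_opM hh) (ktq_hom_opM hh') ea eb ec.
- by rewrite -pRE (ktq_hom_opR hh) (ktq_hom_opR hh') ea eb ec.
Qed.

End UniversalProperty.

Section GenericColoring.

Variable D : diagram.

Definition generic (r : region D) : KTQ D := cls (@diagram_rel D) (Gen r).

Lemma generic_coloring : is_coloring (@opT (KTQ D)) generic.
Proof.
split=> [v i kv si | v i s kv].
- by rewrite [RHS]pTE; apply/clsE/cong_rel/rel_crossing.
- by apply/clsE/cong_rel/rel_marked/kv.
Qed.

Lemma coloring_hom (K : ktq) (f : region D -> K) : is_coloring (@opT K) f ->
  exists2 h : KTQ D -> K, ktq_hom h & forall r, h (generic r) = f r.
Proof.
move=> [fc fm]; apply: presented_hom => t u [v i|v i s]; first exact: fc.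
exact: fm.
Qed.

Lemma hom_coloring (K L : ktq) (h : K -> L) (f : region D -> K) :
  ktq_hom h -> is_coloring (@opT K) f -> is_coloring (@opT L) (h \o f).
Proof.
move=> hh [fc fm]; split=> [v i kv si | v i s kv] /=.
- by rewrite (fc v i) // hh.
- by rewrite (fm v i s).
Qed.

End GenericColoring.


(** A natural way to turn each coloring of [D] into a unique coloring of [D'].  It is
    a relation rather than a function, so that naturality holds for all maps [h]
    and the inverse is the same relation read backwards. *)
Record coloring_transfer (D D' : diagram)
    (E : forall X : Type, (region D -> X) -> (region D' -> X) -> Prop) : Prop := {
  transfer_natural : forall (X Y : Type) (h : X -> Y) f f',
    E X f f' -> E Y (h \o f) (h \o f');
  transfer_exists : forall X (T : X -> X -> X -> X) f, is_ktq T ->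
    is_coloring T f -> exists2 f', is_coloring T f' & E X f f';
  transfer_unique : forall X (T : X -> X -> X -> X) f f1 f2, is_ktq T ->
    is_coloring T f1 -> is_coloring T f2 -> E X f f1 -> E X f f2 -> f1 =1 f2
}.

Section Transfer.

Variables (D D' : diagram).
Variable E : forall X : Type, (region D -> X) -> (region D' -> X) -> Prop.
Let E' (X : Type) f' f := E (X := X) f f'.
Hypotheses (tE : coloring_transfer E) (tE' : coloring_transfer E').

(** Yoneda's argument: [g \o h] fixes the generic coloring because both the generic
    coloring and its image under [g \o h] correspond to [g \o generic]. *)
Lemma transfer_retraction (h : KTQ D -> KTQ D') (g : KTQ D' -> KTQ D) :
    ktq_hom h -> ktq_hom g ->
    E (h \o @generic D) (@generic D') -> E (@generic D) (g \o @generic D') ->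
  cancel h g.
Proof.
move=> hh hg Eh Eg.
apply: (presented_hom_ext (ktq_hom_comp hh hg)) => // r.
have ch := hom_coloring hh (@generic_coloring D).
have cgh := hom_coloring hg ch.
apply: (transfer_unique tE' (opTP _) cgh (@generic_coloring D) _ Eg r).
exact: (transfer_natural tE).
Qed.

End Transfer.

Lemma transfer_isomorphic (D D' : diagram)
    (E : forall X : Type, (region D -> X) -> (region D' -> X) -> Prop) :
    coloring_transfer E -> coloring_transfer (fun X f' f => E X f f') ->
  ktq_isomorphic (KTQ D) (KTQ D').
Proof.
move=> tE tE'.
have [d cd Ed] := transfer_exists tE (opTP _) (@generic_coloring D).
have [e ce Ee] := transfer_exists tE' (opTP _) (@generic_coloring D').
have [h hh hE] := coloring_hom ce; have [g hg gE] := coloring_hom cd.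
have {}hE : e = h \o @generic D by apply/funext=> r; rewrite /= hE.
have {}gE : d = g \o @generic D' by apply/funext=> r; rewrite /= gE.
rewrite {e ce}hE in Ee; rewrite {d cd}gE in Ed.
apply: (bijective_hom_isomorphic hh); exists g.
  exact: (transfer_retraction tE tE').
exact: (@transfer_retraction _ _ (fun X f' f => E X f f')).
Qed.

Lemma transfer_ncolorings_le (D D' : diagram)
    (E : forall X : Type, (region D -> X) -> (region D' -> X) -> Prop)
    (X : finType) (T : X -> X -> X -> X) :
    coloring_transfer E -> coloring_transfer (fun X f' f => E X f f') ->
    is_ktq T ->
  ncolorings D T <= ncolorings D' T.
Proof.
move=> tE tE' ktqT; rewrite /ncolorings.
set A := [set f | _]; set B := [set f | _].

pose F (f : {ffun region D -> X}) := [pick f' in B | `[< E X f f' >]].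
have FP f : f \in A -> exists f', [/\ F f = Some f', f' \in B & E X f f'].
  rewrite inE => /asboolP cf; have [f' cf' Ef] := transfer_exists tE ktqT cf.
  rewrite /F; case: pickP => [f1 /andP[Bf1 /asboolP Ef1] | /(_ (finfun f'))].
    by exists f1.
  have -> : finfun f' = f' :> (_ -> _) by apply/funext=> r; rewrite ffunE.
  case/andP; split; last exact/asboolP.
  rewrite inE; apply/asboolP.
  by have -> : finfun f' = f' :> (_ -> _) by apply/funext=> r; rewrite ffunE.
have injF : {in A &, injective F}.
  move=> f1 f2 Af1 Af2; have [f' [-> _ E1]] := FP _ Af1.
  have [f'' [-> _ E2]] := FP _ Af2; case=> ef; rewrite -{}ef in E2.
  move: Af1 Af2; rewrite !inE => /asboolP c1 /asboolP c2; apply/ffunP.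
  exact: (transfer_unique tE' ktqT c1 c2 E1 E2).
rewrite -(card_in_imset injF) -(card_imset B (@Some_inj _)); apply: subset_leq_card.
apply/subsetP=> _ /imsetP[f Af ->]; have [f' [-> Bf' _]] := FP _ Af.
exact: imset_f.
Qed.

Lemma transfer_ncolorings (D D' : diagram)
    (E : forall X : Type, (region D -> X) -> (region D' -> X) -> Prop)
    (X : finType) (T : X -> X -> X -> X) :
    coloring_transfer E -> coloring_transfer (fun X f' f => E X f f') ->
    is_ktq T ->
  ncolorings D T = ncolorings D' T.
Proof.
move=> tE tE' ktqT; apply/eqP; rewrite eqn_leq.
by rewrite (transfer_ncolorings_le tE tE' ktqT) (transfer_ncolorings_le tE').
Qed.

(** * Colorings of tangles, and gluing *)

Section VertexRelation.

Variables (X : Type) (T : X -> X -> X -> X).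

(** The conditions imposed by one vertex, in terms of the directions and the corners
    of its half-edges only, so as to be transported along gluings and encodings. *)
Definition vertex_rel (k : vkind) (p : 'I_4 -> bool) (x : 'I_4 -> X) : Prop :=
  match k with
  | Crossing => forall i, ~~ p i && p (ordS i) ->
      x (across_over i) = T (x i) (x (across_under i)) (x (opposite i))
  | Marked _ => forall i, x i = x (opposite i)
  end.

Definition tangle_coloring (P : finType) (m : gmap P) (f : region m -> X) : Prop :=
  forall v, vertex_rel (kind m v) (fun i => pos m (half v i))
                       (fun i => f (corner v i)).

Lemma diagram_coloringP (D : diagram) (f : region D -> X) :
  is_coloring T f <-> tangle_coloring f.
Proof.
split=> [[fc fm] v | cf].
  rewrite /vertex_rel; case kv: (kind D v) => [|s] i.
  - exact: fc.
  - exact: fm kv.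
split=> [v i kv|v i s kv]; have := cf v; rewrite /vertex_rel kv; exact.
Qed.

End VertexRelation.

Definition vertex_oriented (k : vkind) (p : 'I_4 -> bool) : Prop :=
  match k with
  | Crossing => forall i, p (ordS (ordS i)) = ~~ p i
  | Marked _ => forall i, p (ordS i) = ~~ p i
  end.

Definition tangle_oriented (P : finType) (m : gmap P) : Prop :=
  forall v, vertex_oriented (kind m v) (fun i => pos m (half v i)).

Section Filling.

Variables (n : nat) (O I : gmap 'I_n) (D : diagram).
Variables (jV : vertex O + vertex I -> vertex D).
Variables (jd : dart O + dart I -> dart D).
Variables (jR : region O + region I -> region D).
Hypothesis fill : is_filling jV jd jR.

Definition outside (X : Type) (f : region D -> X) (a : region O) := f (jR (inl a)).
Definition inside (X : Type) (f : region D -> X) (a : region I) := f (jR (inr a)).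

Lemma filling_arc p : jR (inl (outer_arc O p)) = jR (inr (inner_arc I p)).
Proof.
apply/eqP; rewrite (jR_ker fill); apply: connect1 => /=.
by apply/existsP; exists p; rewrite !eqxx.
Qed.

Lemma filling_pos p : pos O (out O (inr p)) = pos I (rev I (out I (inr p))).
Proof.
rewrite -(pos_O fill) -(pos_I fill); congr (pos D _); apply/eqP.
rewrite (jd_ker fill); apply: connect1 => /=.
by apply/existsP; exists p; rewrite !eqxx.
Qed.

Lemma filling_oriented : tangle_oriented I.
Proof.
have wf := diagram_wf D.
move=> v; rewrite /vertex_oriented -(kind_I fill).
case kv: (kind D (jV (inr v))) => [|s] i; rewrite -!(pos_I fill) -!(half_I fill).
- exact: (crossing_pos wf).
- exact: (marked_pos wf _ kv).
Qed.

Lemma filling_coloring (X : Type) (T : X -> X -> X -> X) (f : region D -> X) :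
  tangle_coloring T f <->
  tangle_coloring T (outside f) /\ tangle_coloring T (inside f).
Proof.
have relO v : vertex_rel T (kind D (jV (inl v)))
    (fun i => pos D (half (jV (inl v)) i)) (fun i => f (corner (jV (inl v)) i)) =
  vertex_rel T (kind O v) (fun i => pos O (half v i))
    (fun i => outside f (corner v i)).
  rewrite (kind_O fill); congr (vertex_rel _ _ _ _); apply/funext=> i.
    by rewrite (half_O fill) (pos_O fill).
  by rewrite /corner /outside (half_O fill) (lft_O fill).
have relI v : vertex_rel T (kind D (jV (inr v)))
    (fun i => pos D (half (jV (inr v)) i)) (fun i => f (corner (jV (inr v)) i)) =
  vertex_rel T (kind I v) (fun i => pos I (half v i))
    (fun i => inside f (corner v i)).
  rewrite (kind_I fill); congr (vertex_rel _ _ _ _); apply/funext=> i.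
    by rewrite (half_I fill) (pos_I fill).
  by rewrite /corner /inside (half_I fill) (lft_I fill).
split=> [cf | [cO cI] v].
  by split=> v; [rewrite -relO | rewrite -relI]; apply: cf.
have [w _ wK] := jV_bij fill; rewrite -(wK v).
by case: (w v) => u; [rewrite relO; apply: cO | rewrite relI; apply: cI].
Qed.

(** The regions of the glued diagram are the classes of those of the two tangles
    under the identifications along the circle, so compatible values descend. *)
Lemma filling_glue (X : Type) (gO : region O -> X) (gI : region I -> X) :
    (forall p, gO (outer_arc O p) = gI (inner_arc I p)) ->
  exists f, outside f = gO /\ inside f = gI.
Proof.
move=> agree; pose g (x : region O + region I) :=
  match x with inl a => gO a | inr a => gI a end.
have [s sK] := boolp.choice (jR_surj fill).
have gE x : g (s (jR x)) = g x.
  have: connect (sym_of (@same_region _ O I)) (s (jR x)) x.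
    by rewrite -(jR_ker fill) sK.
  case/connectP=> q; elim: q (s (jR x)) => [y _ -> // | z q IH y /= /andP[yz zq] e].
  rewrite -(IH z) //; case: y z yz {IH zq e} => [a|a] [b|b] //=.
  - by case/existsP=> p /andP[/eqP-> /eqP->].
  - by case/existsP=> p /andP[/eqP-> /eqP->].
by exists (g \o s); split; apply/funext=> a; rewrite /outside /inside /= gE.
Qed.

Lemma filling_ext (X : Type) (f f' : region D -> X) :
  outside f = outside f' -> inside f = inside f' -> f =1 f'.
Proof.
move=> eO eI r; have [[a|a] <-] := jR_surj fill r.
- exact: (congr1 (fun h => h a) eO).
- exact: (congr1 (fun h => h a) eI).
Qed.

End Filling.

Definition extends_colorings (n : nat) (I I' : gmap 'I_n) : Prop :=
  forall X (T : X -> X -> X -> X) (g : region I -> X), is_ktq T ->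
    tangle_coloring T g ->
  exists2 g' : region I' -> X, tangle_coloring T g' &
    forall p, g (inner_arc I p) = g' (inner_arc I' p).

Definition rigid (n : nat) (I : gmap 'I_n) : Prop :=
  forall X (T : X -> X -> X -> X) (g g' : region I -> X), is_ktq T ->
    tangle_coloring T g -> tangle_coloring T g' ->
    (forall p, g (inner_arc I p) = g' (inner_arc I p)) -> g =1 g'.

Section Replacement.

Variables (n : nat) (O I I' : gmap 'I_n) (D D' : diagram).
Variables (jV : vertex O + vertex I -> vertex D).
Variables (jd : dart O + dart I -> dart D).
Variables (jR : region O + region I -> region D).
Variables (jV' : vertex O + vertex I' -> vertex D').
Variables (jd' : dart O + dart I' -> dart D').
Variables (jR' : region O + region I' -> region D').
Hypotheses (fill : is_filling jV jd jR) (fill' : is_filling jV' jd' jR').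

(** Replacing the inside of a disc transfers colorings as soon as this holds inside
    the disc, with prescribed values along the circle. *)
Lemma replacement_transfer :
    extends_colorings I I' -> rigid I' ->
  coloring_transfer (fun X (f : region D -> X) (f' : region D' -> X) =>
    outside jR f = outside jR' f').
Proof.
move=> ext rig; split.
- move=> X Y h f f' e; apply/funext=> a.
  exact: (congr1 (fun g => h (g a)) e).
- move=> X T f ktqT /diagram_coloringP/(filling_coloring fill)[cO cI].
  have [g' cg' eg'] := ext _ _ _ ktqT cI.
  have [|f' [eO eI]] := filling_glue fill' (gO := outside jR f) (gI := g').
    by move=> p; rewrite -eg' /outside /inside (filling_arc fill).
  exists f'; last by [].
  by apply/diagram_coloringP/(filling_coloring fill'); rewrite eO eI.
- move=> X T f f1 f2 ktqT.
  move=> /diagram_coloringP/(filling_coloring fill')[_ c1].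
  move=> /diagram_coloringP/(filling_coloring fill')[_ c2] e1 e2.
  have e : outside jR' f1 = outside jR' f2 by rewrite -e1.
  apply: (filling_ext fill') => //; apply/funext; apply: (rig _ _ _ _ ktqT) => // p.
  rewrite /inside -(filling_arc fill').
  exact: (congr1 (fun h => h (outer_arc O p)) e).
Qed.

End Replacement.

(** * Colorings of encoded tangles *)

(** The conditions on colorings of an encoded tangle are restated with functions on
    natural numbers, so that they unfold by computation to explicit equations
    between the colors of the numbered regions. *)
Definition code_edge_pos (o : nat -> bool) (d : nat * bool) : bool :=
  if d.2 then o d.1 else ~~ o d.1.

Definition code_left (c : code) (d : nat * bool) : nat :=
  let s := nth (0, 0) (code_sides c) d.1 in if d.2 then s.1 else s.2.

Definition code_right (c : code) (d : nat * bool) : nat :=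
  code_left c (d.1, ~~ d.2).

Definition code_vertex_rel (X : Type) (T : X -> X -> X -> X) (c : code)
    (o : nat -> bool) (g : nat -> X) (vh : vkind * seq (nat * bool)) : Prop :=
  let p i := code_edge_pos o (nth (fw 0) vh.2 i) in
  let x i := g (code_left c (nth (fw 0) vh.2 i)) in
  match vh.1 with
  | Crossing => cross T (p 0) (p 1) (x 0) (x 1) (x 2) (x 3)
  | Marked _ => x 0 = x 2 /\ x 1 = x 3
  end.

Definition code_vertex_oriented (o : nat -> bool) (vh : vkind * seq (nat * bool)) :
    Prop :=
  let p i := code_edge_pos o (nth (fw 0) vh.2 i) in
  match vh.1 with
  | Crossing => p 2 = ~~ p 0 /\ p 3 = ~~ p 1
  | Marked _ => [/\ p 1 = ~~ p 0, p 2 = p 0 & p 3 = ~~ p 0]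
  end.

Definition all_prop (A : Type) (P : A -> Prop) (s : seq A) : Prop :=
  foldr (fun a Q => P a /\ Q) True s.

Definition code_oriented (c : code) (o : nat -> bool) : Prop :=
  all_prop (code_vertex_oriented o) (code_verts c).

Definition code_coloring (X : Type) (T : X -> X -> X -> X) (c : code)
    (o : nat -> bool) (g : nat -> X) : Prop :=
  all_prop (code_vertex_rel T c o g) (code_verts c).

Definition ends_pos (c : code) (o : nat -> bool) : seq bool :=
  map (code_edge_pos o) (code_ends c).

Definition ends_values (X : Type) (c : code) (g : nat -> X) : seq X :=
  map (fun d => g (code_right c d)) (code_ends c).

(** The tables refer only to existing edges and regions, so that the reductions
    modulo their numbers in [tangle] have no effect. *)
Definition code_ok (n : nat) (c : code) : bool :=
  [&& all (fun vh => (size vh.2 == 4) && all (fun d => d.1 <= code_edges c) vh.2)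
        (code_verts c),
      size (code_ends c) == n, all (fun d => d.1 <= code_edges c) (code_ends c) &
      all (fun s => (s.1 <= code_regions c) && (s.2 <= code_regions c))
        (code_sides c)].

Lemma all_propP (A : Type) (x0 : A) (P : A -> Prop) (s : seq A) :
  all_prop P s <-> forall i : 'I_(size s), P (nth x0 s i).
Proof.
split=> [|h].
  elim: s => [_ [] // | a s IH [Pa Ps]] [[|i] lt_i] //=.
  exact: (IH Ps (Ordinal (lt_i : i < size s))).
elim: s h => // a s IH h; split; first exact: (h ord0).
apply: IH => i; exact: (h (lift ord0 i)).
Qed.


Lemma ord4P (Q : 'I_4 -> Prop) :
  Q (inord 0) -> Q (inord 1) -> Q (inord 2) -> Q (inord 3) -> forall i, Q i.
Proof.
move=> h0 h1 h2 h3 i; rewrite -(inord_val i).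
by case: i => [[|[|[|[|]]]]].
Qed.

Lemma across_overE (i : 'I_4) :
  across_over i = nth 0 [:: 1; 0; 3; 2] i :> nat.
Proof. by case: i => [[|[|[|[|]]]]]. Qed.

Lemma across_underE (i : 'I_4) :
  across_under i = nth 0 [:: 3; 2; 1; 0] i :> nat.
Proof. by case: i => [[|[|[|[|]]]]]. Qed.

Lemma ordSE (i : 'I_4) : ordS i = nth 0 [:: 1; 2; 3; 0] i :> nat.
Proof. by case: i => [[|[|[|[|]]]]]. Qed.

Lemma oppositeE (i : 'I_4) : opposite i = nth 0 [:: 2; 3; 0; 1] i :> nat.
Proof. by case: i => [[|[|[|[|]]]]]. Qed.

Section ListedVertex.

Variables (p : nat -> bool).

Lemma vertex_orientedP k : vertex_oriented k (fun i : 'I_4 => p i) ->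
  match k with
  | Crossing => p 2 = ~~ p 0 /\ p 3 = ~~ p 1
  | Marked _ => [/\ p 1 = ~~ p 0, p 2 = p 0 & p 3 = ~~ p 0]
  end.
Proof.
case: k => [|s] h; have := (h (inord 0), h (inord 1), h (inord 2));
  rewrite !ordSE !inordK //=; case=> -[-> ->] //.
by move=> ->; rewrite negbK.
Qed.

(** The condition quantified over the source corner of a crossing amounts to [cross]:
    the directions of the half-edges leave exactly one source corner. *)
Lemma vertex_relP (X : Type) (T : X -> X -> X -> X) (x : nat -> X) k :
    vertex_oriented k (fun i : 'I_4 => p i) ->
  vertex_rel T k (fun i : 'I_4 => p i) (fun i : 'I_4 => x i) <->
  match k with
  | Crossing => cross T (p 0) (p 1) (x 0) (x 1) (x 2) (x 3)
  | Marked _ => x 0 = x 2 /\ x 1 = x 3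
  end.
Proof.
move/vertex_orientedP; case: k => [[p2 p3]|s _]; rewrite /vertex_rel; last first.
  split=> [h|[h0 h1]]; last first.
    by apply: ord4P; rewrite oppositeE inordK.
  by have := (h (inord 0), h (inord 1)); rewrite !oppositeE !inordK //; case.
split=> [h | h].
  move: (h (inord 0)) (h (inord 1)) (h (inord 2)) (h (inord 3)).
  rewrite !oppositeE !ordSE !across_overE !across_underE !inordK //= p2 p3.
  by rewrite /cross; case: (p 0); case: (p 1) => /= h0 h1 h2 h3; symmetry; auto.
apply: ord4P; rewrite oppositeE ordSE across_overE across_underE inordK //= ?p2 ?p3;
  by move: h; rewrite /cross; case: (p 0); case: (p 1).
Qed.

End ListedVertex.

Section CodedTangle.

Variables (n : nat) (c : code) (o : 'I_(code_edges c).+1 -> bool).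
Hypothesis ok : code_ok n c.

Let m : gmap 'I_n := tangle n o.
Let o' (e : nat) : bool := o (inZp e).

Lemma pos_code_dart d : pos m (code_dart c d) = code_edge_pos o' d.
Proof. by case: d => e [] /=; rewrite /code_edge_pos /o' /=; case: (o _). Qed.

Lemma lft_code_dart d : d.1 <= code_edges c ->
  lft m (code_dart c d) = inZp (code_left c d).
Proof. by case: d => e b /= le_e; rewrite /code_left /= modn_small. Qed.


Definition code_lift (X : Type) (g : region m -> X) (r : nat) : X := g (inZp r).

Lemma code_vertexP (v : vertex m) :
  let vh := nth (Crossing, [::]) (code_verts c) v in
  [/\ forall i, half v i = code_dart c (nth (fw 0) vh.2 i) &
      forall (i : 'I_4), (nth (fw 0) vh.2 i).1 <= code_edges c].
Proof.
move=> vh; split=> // i; case/and4P: ok => okv _ _ _.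
have /andP[/eqP sz al] := all_nthP (Crossing, [::]) okv v (ltn_ord v).
by apply: (all_nthP (fw 0) al); rewrite sz.
Qed.

Hypothesis orm : tangle_oriented m.

Lemma code_orientedP : code_oriented c o'.
Proof.
apply/(all_propP (Crossing, [::])) => v.
have [hv _] := code_vertexP v; have := orm v.
set p := fun i => code_edge_pos o' (nth (fw 0) (nth (Crossing, [::]) (code_verts c) v).2 i).
have -> : (fun i => pos m (@half _ m v i)) = (fun i : 'I_4 => p i).
  by apply/funext=> i; rewrite hv pos_code_dart.
exact: vertex_orientedP.
Qed.

Lemma code_coloringP (X : Type) (T : X -> X -> X -> X) (g : region m -> X) :
  tangle_coloring T g <-> code_coloring T c o' (code_lift g).
Proof.
apply: iff_trans (iff_sym (all_propP (Crossing, [::]) _ _)).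
suff h (v : vertex m) : vertex_rel T (kind m v) (fun i => pos m (half v i))
              (fun i => g (corner v i)) <->
    code_vertex_rel T c o' (code_lift g) (nth (Crossing, [::]) (code_verts c) v).
  by split=> cg v; apply/h.
have [hv le_v] := code_vertexP v; have := orm v.
set vh := nth _ _ _ in hv le_v *.
have -> : (fun i => pos m (@half _ m v i)) =
    (fun i : 'I_4 => code_edge_pos o' (nth (fw 0) vh.2 i)).
  by apply/funext=> i; rewrite hv pos_code_dart.
have -> : (fun i => g (@corner _ m v i)) =
    (fun i : 'I_4 => code_lift g (code_left c (nth (fw 0) vh.2 i))).
  by apply/funext=> i; rewrite /corner hv lft_code_dart.
exact: (vertex_relP (p := fun i => code_edge_pos o' (nth (fw 0) vh.2 i)) T
  (fun i => code_lift g (code_left c (nth (fw 0) vh.2 i)))).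
Qed.

Lemma code_endP (p : 'I_n) :
  out m (inr p) = code_dart c (nth (fw 0) (code_ends c) p) /\
  (nth (fw 0) (code_ends c) p).1 <= code_edges c.
Proof.
case/and4P: ok => _ /eqP sz al _; split=> //.
by apply: (all_nthP (fw 0) al); rewrite sz.
Qed.

Lemma inner_arc_code (p : 'I_n) :
  inner_arc m p = inZp (code_right c (nth (fw 0) (code_ends c) p)).
Proof.
rewrite /inner_arc; have [-> le_p] := code_endP p.
by rewrite -[rev _ _]/(code_dart c (_, ~~ _)) lft_code_dart.
Qed.

Lemma pos_rev_end (p : 'I_n) :
  pos m (rev m (out m (inr p))) = ~~ nth false (ends_pos c o') p.
Proof.
case/and4P: ok => _ /eqP sz _ _; have [-> _] := code_endP p.
rewrite /ends_pos (nth_map (fw 0)) ?sz // -pos_code_dart.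
by rewrite /=; case: (nth _ _ _).2; case: (o _).
Qed.

Lemma code_values_arc (X : Type) (g : region m -> X) (p : 'I_n) (x0 : X) :
  nth x0 (ends_values c (code_lift g)) p = g (inner_arc m p).
Proof.
case/and4P: ok => _ /eqP sz _ _.
by rewrite /ends_values (nth_map (fw 0)) ?sz // /code_lift inner_arc_code.
Qed.

End CodedTangle.

Definition code_extends (c c' : code) : Prop :=
  forall X (T : X -> X -> X -> X) o o' g, is_ktq T ->
    code_oriented c o -> code_oriented c' o' -> ends_pos c o = ends_pos c' o' ->
    code_coloring T c o g ->
  exists g', code_coloring T c' o' g' /\ ends_values c g = ends_values c' g'.

Definition code_rigid (c : code) : Prop :=
  forall X (T : X -> X -> X -> X) o g g', is_ktq T ->
    code_oriented c o -> code_coloring T c o g -> code_coloring T c o g' ->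
    ends_values c g = ends_values c g' ->
  all_prop (fun r => g r = g' r) (iota 0 (code_regions c).+1).

Lemma code_rigid_tangle n c (o : 'I_(code_edges c).+1 -> bool) :
    code_ok n c -> code_rigid c -> tangle_oriented (tangle n o) ->
  rigid (tangle n o).
Proof.
move=> ok rig orm X T g g' ktqT cg cg' e r.
have liftK (h : region (tangle n o) -> X) : h r = code_lift h r.
  by rewrite /code_lift valZpK.
rewrite !liftK.
suff /(all_propP 0) : all_prop (fun r => code_lift g r = code_lift g' r)
    (iota 0 (code_regions c).+1).
  rewrite size_iota => /(_ r); rewrite nth_iota //; exact.
apply: (rig X T _ _ _ ktqT (code_orientedP ok orm)); try exact/code_coloringP.
case/and4P: (ok) => _ /eqP sz _ _.
apply: (@eq_from_nth _ (g r)); rewrite ?size_map // sz => p lt_p.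
by rewrite !(@code_values_arc _ _ _ ok _ _ (Ordinal lt_p)).
Qed.

Lemma code_ok_left n c d : code_ok n c -> code_left c d <= code_regions c.
Proof.
case/and4P=> _ _ _ oks; rewrite /code_left.
have [lt_d | ge_d] := ltnP d.1 (size (code_sides c)).
  by have /andP[h1 h2] := all_nthP (0, 0) oks _ lt_d; case: d.2.
by rewrite nth_default //=; case: d.2.
Qed.

Lemma code_extends_tangle n c c' (o : 'I_(code_edges c).+1 -> bool)
    (o' : 'I_(code_edges c').+1 -> bool) :
    code_ok n c -> code_ok n c' -> code_extends c c' ->
    tangle_oriented (tangle n o) -> tangle_oriented (tangle n o') ->
    (forall p, pos (tangle n o) (rev (tangle n o) (out (tangle n o) (inr p))) =
               pos (tangle n o') (rev (tangle n o') (out (tangle n o') (inr p)))) ->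
  extends_colorings (tangle n o) (tangle n o').
Proof.
move=> ok ok' ext orm orm' e X T g ktqT cg.
case/and4P: (ok) => _ /eqP sz _ _; case/and4P: (ok') => _ /eqP sz' _ _.
have [|g' [cg' eg']] := ext X T _ _ _ ktqT (code_orientedP ok orm)
    (code_orientedP ok' orm') _ ((code_coloringP ok orm T g).1 cg).
  apply: (@eq_from_nth _ false); rewrite ?size_map ?sz // => p lt_p.
  have := e (Ordinal lt_p); rewrite !pos_rev_end // => /negb_inj.
  exact.
pose h (r : region (tangle n o')) := g' r.
have hE r : r <= code_regions c' -> code_lift (o := o') (n := n) h r = g' r.
  by move=> le_r; rewrite /code_lift /h /= modn_small.
exists h.
  apply/code_coloringP => //.
  suff -> : code_coloring T c' (fun e => o' (inZp e)) (code_lift h) =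
     code_coloring T c' (fun e => o' (inZp e)) g' by [].
  rewrite /code_coloring; congr (all_prop _ _); apply/funext=> -[[|s] hs];
    by rewrite /code_vertex_rel /= !hE ?(code_ok_left _ ok').
move=> p; have := congr1 (fun s => nth (g ord0) s p) eg'.
rewrite code_values_arc // => ->; rewrite -(code_values_arc ok' _ _ (g ord0)).
rewrite /ends_values !(nth_map (fw 0)) ?sz' //.
by rewrite hE // /code_right (code_ok_left _ ok').
Qed.

(** * The moves *)

Lemma ktq_fun (X : Type) (T : X -> X -> X -> X) a b c d d' :
  T a b c = d -> T a b c = d' -> d = d'.
Proof. by move=> <-. Qed.

Ltac code_unfold :=
  unfold code_oriented, code_coloring, ends_pos, ends_values in *; simpl in *;
  unfold code_vertex_oriented, code_vertex_rel, code_edge_pos, code_right,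
    code_left in *; simpl in *.

(* Colors and directions become variables, so that equations between them can be
   substituted. *)
Ltac name_values :=
  repeat match goal with
  | g : nat -> _ |- context [?f ?k] => constr_eq f g;
      let v := fresh "v" in set (v := g k) in *; clearbody v
  | g : nat -> _, H : context [?f ?k] |- _ => constr_eq f g;
      let v := fresh "v" in set (v := g k) in *; clearbody v
  end.

Ltac split_hyps :=
  repeat match goal with
  | H : _ /\ _ |- _ => destruct H
  | H : [/\ _, _ & _] |- _ => destruct H
  | H : _ :: _ = _ :: _ |- _ => injection H; clear H; intros
  end.

(* Once the directions are known, [cross] is an equation [T a b c = d]. *)
Ltac orientation_cases :=
  repeat match goal with
  | H : ?b = ?b :> bool |- _ => clear H
  | H : True |- _ => clear H
  | b : bool |- _ => destruct b; cbn in *; try discriminate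
  end.

Ltac cancel :=
  repeat match goal with
  | H : ?x = ?y |- _ => is_var x; is_var y; destruct H
  | k : is_ktq ?T, H : ?T ?a ?b ?c = ?d, H' : ?T ?a' ?b ?c = ?d |- _ =>
      assert_fails (constr_eq a a'); pose proof (ktq_inj1 k H H')
  | k : is_ktq ?T, H : ?T ?a ?b ?c = ?d, H' : ?T ?a ?b' ?c = ?d |- _ =>
      assert_fails (constr_eq b b'); pose proof (ktq_inj2 k H H')
  | k : is_ktq ?T, H : ?T ?a ?b ?c = ?d, H' : ?T ?a ?b ?c' = ?d |- _ =>
      assert_fails (constr_eq c c'); pose proof (ktq_inj3 k H H')
  | k : is_ktq ?T, H : ?T ?a ?b ?c = ?d, H' : ?T ?a ?b ?c = ?d' |- _ =>
      assert_fails (constr_eq d d'); pose proof (ktq_fun H H')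
  end.

Ltac by_cancellation :=
  unfold code_rigid; intros; code_unfold; name_values; split_hyps; orientation_cases; cancel;
  repeat split; first [reflexivity | assumption].

Definition code_equivalent (c c' : code) : Prop :=
  [/\ code_rigid c, code_rigid c', code_extends c c' & code_extends c' c].

Lemma kink_equivalent b : code_equivalent (kink (crs b)) one_strand.
Proof.
split; first by case: b; by_cancellation.
- by_cancellation.
- by case: b => X T o o' g *; exists g; by_cancellation.
case: b => X T o o' g ktqT *.
(* The color of the loop is determined by the relation at the crossing. *)
- have [x hx] := cross_solve2 ktqT (~~ o' 2) (o' 1) (g 1) (g 0) (g 0).
  by exists (nth x [:: g 0; g 1; x]); by_cancellation.
- have [x hx] := cross_solve2 ktqT (~~ o' 0) (o' 2) (g 1) (g 0) (g 0).
  by exists (nth x [:: g 0; g 1; x]); by_cancellation.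
Qed.

Lemma marked_kink_equivalent s : code_equivalent (kink (dbl (Marked s))) one_strand.
Proof.
split; [by_cancellation | by_cancellation | |] => X T o o' g *.
- by exists g; by_cancellation.
- by exists (nth (g 0) [:: g 0; g 1; g 1]); by_cancellation.
Qed.

Lemma bigon_equivalent : code_equivalent bigon two_strands.
Proof.
split; [by_cancellation | by_cancellation | |] => X T o o' g ktqT *.
- by exists (nth (g 0) [:: g 0; g 1; g 3]); by_cancellation.
(* The color of the region between the two crossings. *)
have [x hx] := cross_solve2 ktqT (~~ o 0) (~~ o 1) (g 1) (g 2) (g 0).
by exists (nth (g 0) [:: g 0; g 1; x; g 2; g 1]); by_cancellation.
Qed.

(** In the calls to [consistency], the strands are listed from the bottom to the top
    and the first vertex is the region inside the triangle; the new vertex [y] is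
    the color inside the triangle of the other side. *)
Lemma triangle_equivalent b : code_equivalent (triangle_L b) (triangle_R b).
Proof.
split; [by case: b; by_cancellation | by case: b; by_cancellation | |];
  case: b => X T o o' g ktqT *; code_unfold.
- have [|||y [? ? ?]] := @consistency _ _ ktqT (o 6) (o 3) (~~ o 0)
    (g 2) (g 4) (g 0) (g 3) (g 6) (g 5) (g 1); try by_cancellation.
  by exists (nth y [:: g 0; g 1; g 6; y; g 4; g 5; g 3]); by_cancellation.
- have [|||y [? ? ?]] := @consistency _ _ ktqT (o 0) (o 3) (~~ o 6)
    (g 2) (g 3) (g 0) (g 4) (g 1) (g 5) (g 6); try by_cancellation.
  by exists (nth y [:: g 0; g 1; g 6; y; g 4; g 5; g 3]); by_cancellation.
- have [|||y [? ? ?]] := @consistency _ _ ktqT (~~ o 6) (~~ o 3) (o 0)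
    (g 3) (g 1) (g 5) (g 2) (g 6) (g 0) (g 4); try by_cancellation.
  by exists (nth y [:: g 0; g 1; y; g 6; g 4; g 5; g 2]); by_cancellation.
- have [|||y [? ? ?]] := @consistency _ _ ktqT (~~ o 0) (~~ o 3) (o 6)
    (g 3) (g 2) (g 5) (g 1) (g 4) (g 0) (g 6); try by_cancellation.
  by exists (nth y [:: g 0; g 1; y; g 6; g 4; g 5; g 2]); by_cancellation.
Qed.

(** Opposite corners of the vertex have the same color, so both crossings of the
    strand relate the same two colors at the vertex to the two colors across the
    strand. *)
Lemma strand_equivalent s b : code_equivalent (strand_right s b) (strand_left s b).
Proof.
split; [by case: b; by_cancellation | by case: b; by_cancellation | |];
  case: b => X T o o' g *.
1,2: by exists (nth (g 0) [:: g 0; g 1; g 2; g 6; g 4; g 5; g 2]); by_cancellation.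
all: by exists (nth (g 0) [:: g 0; g 1; g 6; g 3; g 4; g 5; g 3]); by_cancellation.
Qed.

(** The two edges that are twisted bound the same color on their outer sides; the
    relation at the crossing thus involves three colors, which the vertex, on either
    side of the crossing, leaves in the same places. *)
Lemma twist_equivalent s b : code_equivalent (twist_right s b) (twist_left s b).
Proof.
split; [by case: b; by_cancellation | by case: b; by_cancellation | |];
  case: b => X T o o' g *.
1,2: by exists (nth (g 0) [:: g 0; g 1; g 1; g 4; g 4]); by_cancellation.
all: by exists (nth (g 0) [:: g 0; g 1; g 1; g 0; g 4]); by_cancellation.
Qed.

Lemma slide_equivalent s : code_equivalent (slide_L s) (slide_R s).
Proof.
by split; [by_cancellation | by_cancellation | |] => X T o o' g *; exists g;
  by_cancellation.
Qed.

Lemma bands_rigid s b w u : code_rigid (bands s b w u).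
Proof. by case: b; case: w; case: u; by_cancellation. Qed.

(** The last two regions lie beyond the marked vertices, which give them the colors
    at the corresponding ends of the insides of the two bands.  Along the horizontal
    band, the first color is restored after the two edges of the vertical band, which
    cross a given edge at the same height and in opposite directions.  Along the
    vertical band it is not, as this band goes over one edge and under the other, so
    the color depends on the end where the vertex is. *)
Lemma bands_extend s b w w' u u' : code_extends (bands s b w u) (bands s b w' u').
Proof.
move=> X T o o' g *.
exists (nth (g 0) [:: g 0; g 1; g 2; g 3; g 4; g 5; g 6; g 7; g 8; g 1;
                      if u' then g 2 else g 7]).
by destruct b, w, w', u, u'; by_cancellation.
Qed.

Lemma yoshikawa_equivalent n c c' : yoshikawa n c c' -> code_equivalent c c'.
Proof.
case=> *.
- exact: kink_equivalent.
- exact: bigon_equivalent.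
- exact: triangle_equivalent.
- exact: strand_equivalent.
- exact: strand_equivalent.
- exact: twist_equivalent.
- exact: marked_kink_equivalent.
- exact: marked_kink_equivalent.
- exact: slide_equivalent.
- by split; [apply: bands_rigid | apply: bands_rigid | apply: bands_extend
             | apply: bands_extend].
Qed.

Lemma yoshikawa_ok n c c' : yoshikawa n c c' -> code_ok n c && code_ok n c'.
Proof.
case=> //; do ?by case.
- by move=> s [].
- by move=> s [] [] [].
Qed.

(** * Invariance *)

Lemma yoshikawa_step_transfer D D' : yoshikawa_step D D' ->
  exists E : forall X : Type, (region D -> X) -> (region D' -> X) -> Prop,
    coloring_transfer E /\ coloring_transfer (fun X f' f => E X f f').
Proof.
case=> n c c' O o o' move_cc' _ [jV [jd [jR fill]]] [jV' [jd' [jR' fill']]].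
have /andP[ok ok'] := yoshikawa_ok move_cc'.
have [rig rig' ext ext'] := yoshikawa_equivalent move_cc'.
have or := filling_oriented fill; have or' := filling_oriented fill'.
have same_pos p := etrans (esym (filling_pos fill p)) (filling_pos fill' p).
exists (fun X f f' => outside jR f = outside jR' f'); split.
  apply: (replacement_transfer fill fill'); last exact: code_rigid_tangle.
  exact: (code_extends_tangle ok ok').
have tr : coloring_transfer (fun X (f' : region D' -> X) (f : region D -> X) =>
    outside jR' f' = outside jR f).
  apply: (replacement_transfer fill' fill); last exact: code_rigid_tangle.
  exact: (code_extends_tangle ok' ok).
case: tr => nat ex un; split=> [X Y h f f' /esym e|X T f kT /(ex X T f kT)[f' cf' e]|].
- exact/esym/nat.
- by exists f'.
- move=> X T f f1 f2 kT c1 c2 /esym e1 /esym e2; exact: (un X T f).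
Qed.

Theorem lemma3p12 (D D' : diagram)
    (hF : on_compact_surface D \/ on_plane D)
    (hDD' : yoshikawa_equiv D D') :
  ktq_isomorphic (KTQ D) (KTQ D') /\
  (forall (X : finType) (T : X -> X -> X -> X), is_ktq T ->
     ncolorings D T = ncolorings D' T).
Proof.
clear hF; elim: hDD' => {D D'} [D D' /yoshikawa_step_transfer[E [tE tE']] | D
    | D D' _ [iso num] | D1 D2 D3 _ [iso12 num12] _ [iso23 num23]].
- split; first exact: (transfer_isomorphic tE tE').
  by move=> X T; apply: (transfer_ncolorings tE tE').
- by split; first exact: ktq_isomorphic_refl.
- split; first exact: ktq_isomorphic_sym.
  by move=> X T kT; rewrite num.
- split; first exact: ktq_isomorphic_trans iso12 iso23.
  by move=> X T kT; rewrite num12 // num23.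
Qed.
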